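(* Let $p$ be a prime number, $t\geq1$, and let $\mathcal{H}_1,\ldots,\mathcal{H}_t$ be finite hypergraphs. Set $\eta=\min_{i\in[t]}\big(|V(\mathcal{H}_i)|-\operatorname{alt}^{p}(\mathcal{H}_i)\big)$. Then for any proper coloring $c$ of $\operatorname{KG}^p(\mathcal{H}_1)\times\cdots\times\operatorname{KG}^p(\mathcal{H}_t)$, this hypergraph contains a colorful (with respect to $c$), balanced, complete $p$-partite subhypergraph with $\eta$ vertices.
   Context: A hypergraph $\mathcal{H}$ consists of a finite vertex set $V(\mathcal{H})$ and a family $E(\mathcal{H})$ of nonempty subsets (hyperedges). A proper coloring has no monochromatic hyperedge. $\operatorname{KG}^p(\mathcal{H})$ is the $p$-uniform hypergraph with vertex set $E(\mathcal{H})$ whose hyperedges are the $p$-sets of pairwise disjoint hyperedges of $\mathcal{H}$. The categorical product $\mathcal{G}_1\times\cdots\times\mathcal{G}_t$ has vertex set $V(\mathcal{G}_1)\times\cdots\times V(\mathcal{G}_t)$, a set $e$ of vertices being a hyperedge iff each coordinate projection $\pi_i(e)$ is a hyperedge of $\mathcal{G}_i$. Let $\mathbb{Z}_p=\{\omega,\ldots,\omega^p\}$ be the multiplicative cyclic group of order $p$. For $X=(x_1,\ldots,x_n)\in(\mathbb{Z}_p\cup\{0\})^n$, an alternating subsequence is $x_{i_1},\ldots,x_{i_m}$ with $i_1<\cdots<i_m$, all $x_{i_j}\neq0$ and $x_{i_j}\neq x_{i_{j+1}}$; $\operatorname{alt}(X)$ is the maximum length of such a subsequence ($\operatorname{alt}(\mathbf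 0)=0$). For $\varepsilon\in\mathbb{Z}_p$, $X^{\varepsilon}=\{i: x_i=\varepsilon\}$. For a hypergraph $\mathcal{H}$ with $n$ vertices and a bijection $\sigma:[n]\to V(\mathcal{H})$, $\operatorname{alt}^p_\sigma(\mathcal{H})=\max\{\operatorname{alt}(X): X\in(\mathbb{Z}_p\cup\{0\})^n,\ \text{no hyperedge of }\mathcal{H}\text{ is contained in }\sigma(X^\varepsilon)\text{ for any }\varepsilon\in\mathbb{Z}_p\}$, and $\operatorname{alt}^p(\mathcal{H})=\min_\sigma\operatorname{alt}^p_\sigma(\mathcal{H})$. Given a $p$-uniform hypergraph $\mathcal{G}$ with proper coloring $c$, a colorful, balanced, complete $p$-partite subhypergraph with $q$ vertices means pairwise disjoint $V_1,\ldots,V_p\subseteq V(\mathcal{G})$ with $\sum|V_i|=q$, $\big||V_i|-|V_j|\big|\leq1$, every $p$-set with exactly one vertex in each $V_i$ a hyperedge of $\mathcal{G}$, and vertices within each $V_i$ receiving pairwise distinct colors under $c$. *)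

(* Defs.v *)
From mathcomp Require Import all_boot.

Set Implicit Arguments.
Unset Strict Implicit.
Unset Printing Implicit Defensive.

Record hypergraph := Hypergraph {
  vertex : finType;
  hyperedges : {set {set vertex}};
  hyperedges_neq0 : set0 \notin hyperedges
}.

Definition proper_coloring (G : hypergraph) (C : eqType) (c : vertex G -> C) :=
  forall e : {set vertex G}, e \in hyperedges G ->
    ~ exists k : C, forall x, x \in e -> c x = k.

Section Kneser.

Variables (p : nat) (p_gt0 : 0 < p) (H : hypergraph).

Definition kneser_vertex : finType := {A : {set vertex H} | A \in hyperedges H}.

Definition kneser_hyperedges : {set {set kneser_vertex}} :=
  [set e : {set kneser_vertex} | (#|e| == p) &&
    [forall A in e, forall B in e, (A != B) ==> [disjoint val A & val B]]].

Lemma kneser_hyperedges_neq0 : set0 \notin kneser_hyperedges.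
Proof. by rewrite inE cards0 ltn_eqF. Qed.

Definition kneser : hypergraph := Hypergraph kneser_hyperedges_neq0.

End Kneser.

Section Product.

Variables (t : nat) (t_gt0 : 0 < t) (G : 'I_t -> hypergraph).

Definition prod_vertex : finType := {dffun forall i : 'I_t, vertex (G i)}.

Definition prod_proj (i : 'I_t) (e : {set prod_vertex}) : {set vertex (G i)} :=
  [set x i | x : prod_vertex in e].

(* Hyperedges may have any cardinality: as in the usual set-theoretic
   definition, a product of p-uniform hypergraphs can contain hyperedges with
   more than p vertices. *)
Definition prod_hyperedges : {set {set prod_vertex}} :=
  [set e : {set prod_vertex} | [forall i, prod_proj i e \in hyperedges (G i)]].

Lemma prod_hyperedges_neq0 : set0 \notin prod_hyperedges.
Proof.
apply/negP; rewrite inE => /forallP /(_ (Ordinal t_gt0)).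
by rewrite /prod_proj imset0; apply/negP/hyperedges_neq0.
Qed.

Definition categorical_product : hypergraph := Hypergraph prod_hyperedges_neq0.

End Product.

Section Alternation.

Variable p : nat.

(* The label omega^j of Z_p is represented by the residue of j in 'I_p (only
   equality of labels matters below), and 0 by None. *)
Definition signed_vector (n : nat) := n.-tuple (option 'I_p).

Definition alternating (s : seq (option 'I_p)) : bool :=
  all isSome s && sorted (fun a b => a != b) s.

(* A bit mask encodes the increasing positions of the subsequence. *)
Definition alt (n : nat) (X : signed_vector n) : nat :=
  \max_(m : n.-tuple bool | alternating (mask m X)) size (mask m X).

Definition label_class (n : nat) (X : signed_vector n) (eps : 'I_p) : {set 'I_n} :=
  [set i | tnth X i == Some eps].

Variable H : hypergraph.

Definition ordering := {ffun 'I_#|vertex H| -> vertex H}.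

Definition edge_free (s : ordering) (X : signed_vector #|vertex H|) : bool :=
  ~~ [exists eps : 'I_p, exists A in hyperedges H, A \subset s @: label_class X eps].

Definition alt_ordering (s : ordering) : nat :=
  \max_(X : signed_vector #|vertex H| | edge_free s X) alt X.

(* As the domain and codomain of s have the same cardinality, the injective s are
   exactly the bijections; enum_val is one, so this is a genuine minimum. *)
Definition alt_number : nat :=
  alt_ordering [arg min_(s < (finfun enum_val : ordering) | injectiveb s)
                  alt_ordering s].

End Alternation.

Definition alt_defect (p : nat) (H : hypergraph) : nat :=
  #|vertex H| - alt_number p H.

Definition min_alt_defect (p t : nat) (t_gt0 : 0 < t) (H : 'I_t -> hypergraph) : nat :=
  alt_defect p (H [arg min_(i < Ordinal t_gt0) alt_defect p (H i)]).

Definition has_colorful_balanced_complete_partite (p : nat) (G : hypergraph)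
    (C : eqType) (c : vertex G -> C) (q : nat) : Prop :=
  exists W : 'I_p -> {set vertex G},
    [/\ forall i j, i != j -> [disjoint W i & W j],
        \sum_i #|W i| = q,
        forall i j, #|W i| <= #|W j| + 1,
        forall e : {set vertex G}, #|e| = p ->
          (forall i, #|e :&: W i| = 1) -> e \in hyperedges G
      & forall i, {in W i &, injective c}].

(* Main.v *)
Require Import Defs.
From mathcomp Require Import all_boot all_algebra.
From mathcomp Require Import ring zify.

(** The topological input is a combinatorial form of Dold's theorem. Write
    nonzero vectors of [(Z_p \cup {0})^N] as a poset, with [X <= Y] when [Y] extends
    [X]. If [sgn] is a [Z_p]-equivariant map from this poset to [Z_p], then some full
    flag [X_1 < ... < X_N] satisfies [sgn X_i <> sgn X_(i+1)] for all [i]. To see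
    this, one evaluates the cocycle generating [H^(N-1)(Z_p; Z_p)], pulled back along
    [sgn], on an explicit fundamental chain built by iterated cones: the value is 1,
    while the cocycle vanishes on flags with two equal consecutive signs. Hence an
    equivariant sign together with a monotone level, such that comparable vectors of
    equal level have equal signs, must reach level at least [N].

    Take [N = \sum_i |V(H_i)|] and cut a vector into blocks [X(i)]. In block [i]
    let [a_i = alt^p(H_i)] and let [S_i] be the set of labels [eps] such that
    [X(i)^eps] contains a hyperedge. The block level is [alt(X(i))] up to [a_i], then
    [a_i + min(|S_i|, |X(i)| - a_i)] below [a_i + p], and [|X(i)|] once the block is
    full, i.e. when that minimum reaches [p]. While some block is not full, the sum
    of the block levels is at most [N - eta + p - 1]. When all blocks are full, every
    label [eps] carries at least one vertex of the product, no color occurs at all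
    [p] labels, and the level is [N - eta + l], where [l] is the largest size of a
    balanced family of colors. As some vector has level at least [N], some [l] is at
    least [eta]. If [eta < p] one only needs [eta] vertices. *)

Set Implicit Arguments.
Unset Strict Implicit.
Unset Printing Implicit Defensive.

Import GRing.Theory.
Local Open Scope ring_scope.

(** * Alternating flags *)

Section Cochains.

Variables (T : Type) (R : comNzRingType).
Implicit Types (u w : seq T -> R) (s : seq T).

(* A sequence is a simplex of the augmented simplicial set on [T], the empty sequence
   being the simplex of dimension -1, and [delta] is the coboundary. *)
Fixpoint delta u s : R :=
  if s is x :: s' then u s' - delta (fun l => u (x :: l)) s' else 0.

Lemma deltaB u w s : delta (fun l => u l - w l) s = delta u s - delta w s.
Proof. by elim: s u w => /= [|x s IH] u w; rewrite ?subr0 // IH; ring. Qed.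

Lemma delta0 u s : u =1 (fun=> 0) -> delta u s = 0.
Proof.
by elim: s u => //= x s IH u u0; rewrite u0 IH ?subr0 // => l; apply: u0.
Qed.

Lemma delta_sum (J : Type) (r : seq J) (F : J -> seq T -> R) s :
  delta (fun l => \sum_(j <- r) F j l) s = \sum_(j <- r) delta (F j) s.
Proof.
elim: s F => /= [|x s IH] F; first by rewrite big1.
by rewrite IH -sumrB.
Qed.

Lemma deltaZ a u s : delta (fun l => a * u l) s = a * delta u s.
Proof. by elim: s u => /= [|x s IH] u; rewrite ?mulr0 // IH mulrBr. Qed.

(* Dual of the cone operator sending [x_1 ... x_k] to the alternating sum of the
   [x_1 ... x_i, v x_i, ..., v x_k], where [x_0 = y]. *)
Fixpoint ins (v : T -> T) (y : T) u s : R :=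
  u (v y :: map v s) - (if s is x :: s' then ins v x (fun l => u (x :: l)) s' else 0).

Lemma insB v y u w s : ins v y (fun l => u l - w l) s = ins v y u s - ins v y w s.
Proof.
elim: s y u w => /= [|x s IH] y u w; first by rewrite !subr0.
by rewrite (IH _ (fun l => u (x :: l))); ring.
Qed.

End Cochains.

Lemma delta_map (T T' : Type) (R : comNzRingType) (f : T -> T') (u : seq T' -> R) s :
  delta u (map f s) = delta (fun l => u (map f l)) s.
Proof. by elim: s u => //= x s IH u; rewrite IH. Qed.

(** The cone is a contracting homotopy; counting the empty simplex as a face removes the usual
    correction in dimension 0. *)
Lemma ins_delta (T : Type) (R : comNzRingType) v y (u : seq T -> R) s :
  ins v y (delta u) s + delta (ins v y u) s = u s.
Proof.
elim: s y u => [|x s IH] y u /=; first by rewrite !subr0 addr0.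
rewrite (insB v x u (delta (fun l => u (x :: l)))).
rewrite (deltaB (fun l => u (v y :: v x :: map v l))).
have := IH x (fun l => u (x :: l)); rewrite -(delta_map v (fun l => u (v y :: v x :: l))).
have E z : ins v z u s = u (v z :: map v s) -
   (if s is x' :: s' then ins v x' (fun l => u (x' :: l)) s' else 0) by case: (s).
by rewrite !E => <-; ring.
Qed.

(** * Cocycles of Z_p built from carries *)

Section CarryCocycle.

Variable q : nat.
Local Notation Z := 'I_q.+2.
Implicit Types (x y : Z) (s : seq Z) (u : seq Z -> Z).

(** Records whether the upward cyclic walk from [x] to [y] wraps past 0. Its coboundary [carry2] is
    translation invariant, though [carry] is not. *)
Definition carry x y : Z := (y < x)%N%:R.

Definition carry2 x y z : Z := carry y z - carry x z + carry x y.

Lemma Zp_val_add1 x : (x + 1 : Z) = (if x == ord_max then 0 else x.+1)%N :> nat.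
Proof.
rewrite /= [(1 %% _)%N]modn_small // addn1.
case: eqP => [->|/eqP zm] /=; first by rewrite modnn.
by rewrite modn_small // ltnS ltn_neqAle -ltnS ltn_ord andbT.
Qed.

Lemma carry_add1 x y :
  carry (x + 1) (y + 1) = carry x y + (y == ord_max)%:R - (x == ord_max)%:R.
Proof.
rewrite /carry !Zp_val_add1.
case: eqP => [->|/eqP ym]; case: eqP => [->|/eqP xm] //=.
- by rewrite !ltnn addrK.
- by rewrite ltnNge -ltnS ltn_ord /= add0r subr0.
- have -> : (y < q.+1)%N by rewrite ltn_neqAle -ltnS ltn_ord andbT.
  by rewrite addr0 subrr.
- by rewrite ltnS addr0 subr0.
Qed.

Lemma carry2_add1 x y z : carry2 (x + 1) (y + 1) (z + 1) = carry2 x y z.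
Proof. by rewrite /carry2 !carry_add1; ring. Qed.

Lemma carry2_addn x y z n : carry2 (x + n%:R) (y + n%:R) (z + n%:R) = carry2 x y z.
Proof.
elim: n => [|n IH]; first by rewrite !addr0.
by rewrite -natr1 !addrA carry2_add1.
Qed.

Lemma carryxx x : carry x x = 0. Proof. by rewrite /carry ltnn. Qed.

Lemma Zp_charE : q.+2%:R = 0 :> Z.
Proof. by rewrite Zp_nat; apply/val_inj; rewrite /= modnn. Qed.

(** The sum over translates is additive along [a], [b], [d]: the defect is [q.+2] equal values of
    the invariant [carry2]. For a unit step it is 1, as exactly one translate wraps. *)
Lemma sum_carry x y : \sum_(n < q.+2) carry (x + n%:R) (y + n%:R) = y - x.
Proof.
pose nc x y := \sum_(n < q.+2) carry (x + n%:R) (y + n%:R); rewrite -/(nc x y).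
have ncD a b d : nc a b + nc b d = nc a d.
  apply/eqP; rewrite -subr_eq0 -big_split -sumrB /=; apply/eqP.
  rewrite (eq_bigr (fun=> carry2 a b d)) => [|n _].
    by rewrite sumr_const card_ord -mulr_natr Zp_charE mulr0.
  by rewrite -(carry2_addn a b d n) /carry2; ring.
have nc1 a : nc a (a + 1) = 1.
  rewrite /nc.
  pose f (n : 'I_q.+2) : Z := a + n.
  have f_inj : injective f by move=> m n /addrI.
  transitivity (\sum_(y : Z) carry y (y + 1)).
    rewrite [RHS](reindex_inj f_inj) /=; apply: eq_bigr => n _.
    by rewrite /f -[in RHS](natr_Zp n) addrAC.
  rewrite (bigD1 ord_max) //= big1 ?addr0 => [|n nm].
    by rewrite /carry Zp_val_add1 eqxx.
  by rewrite /carry Zp_val_add1 (negPf nm) ltnNge leqnSn.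
have ncn n a : nc a (a + n%:R) = n%:R.
  elim: n => [|n IH]; last by rewrite -natr1 addrA -(ncD _ (a + n%:R)) IH nc1.
  by rewrite addr0; apply: big1 => i _; rewrite carryxx.
by rewrite -[in LHS](subrK x y) addrC -[X in nc _ (_ + X)]natr_Zp ncn natr_Zp.
Qed.

(** Cup product with [carry2]: front face times back face. *)
Definition cup u s : Z :=
  if s is x :: y :: z :: s' then carry2 x y z * u (z :: s') else 0.

(* [theta k] represents the generator of [H^k(Z_p; Z_p)]: a power of the carry cocycle
   [carry2], times the tautological 1-cocycle when [k] is odd. The [mu k] are
   non-invariant primitives of [theta k.+1] that transgress to [theta k]. *)
Fixpoint theta (k : nat) : seq Z -> Z :=
  match k with
  | 0 => fun s => (size s == 1)%N%:R
  | 1 => fun s => if s is [:: x; y] then y - x else 0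
  | k'.+2 => cup (theta k')
  end.

Fixpoint mu (k : nat) : seq Z -> Z :=
  match k with
  | 0 => fun s => if s is [:: x] then x else 0
  | 1 => fun s => if s is [:: x; y] then carry x y else 0
  | k'.+2 => cup (mu k')
  end.

Lemma nat_ind2 (P : nat -> Prop) :
  P 0%N -> P 1%N -> (forall k, P k -> P k.+2) -> forall k, P k.
Proof. by move=> P0 P1 PS k; suff [] : P k /\ P k.+1 by []; elim: k => // k []; auto. Qed.

(** [carry2] is a cocycle of even degree, hence no sign and no extra term. The condition on [[::]]
    enters because [delta u [:: z]] is [u [::]]. *)
Lemma delta_cup u s : u [::] = 0 -> delta (cup u) s = cup (delta u) s.
Proof.
move=> u0; case: s => [|x [|y [|z s]]] //=; rewrite ?subr0 ?subrr //.
case: s => [|a s] /=; first by rewrite !u0; ring.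
by rewrite !deltaZ /carry2; ring.
Qed.

Lemma mu_nil k : mu k [::] = 0. Proof. by case: k => [|[|k]]. Qed.

Lemma delta_mu k s : delta (mu k) s = theta k.+1 s.
Proof.
elim/nat_ind2: k s => [||k IH] s.
- case: s => [|x [|y [|z s]]] //=; rewrite ?subr0 //.
  by rewrite delta0 //; ring.
- case: s => [|x [|y [|z [|a s]]]] //=; rewrite ?subr0 //.
    by rewrite mulr1 /carry2; ring.
  by rewrite delta0 // /cup /= mulr0; ring.
- transitivity (cup (delta (mu k)) s); first exact/delta_cup/mu_nil.
  change (cup (delta (mu k)) s = cup (theta k.+1) s).
  by case: s => [|x [|y [|z s]]] //; rewrite /cup IH.
Qed.

(** Cupping with the invariant [carry2] preserves the identity, so only degree 0 is computed. The
    odd case reduces likewise to [sum_carry]. *)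
Lemma mu_even k s : ~~ odd k -> mu k [seq x + 1 | x <- s] - mu k s = theta k s.
Proof.
elim/nat_ind2: k s => [||k IH] s //.
  by case: s => [|x [|y s]] //= _; ring.
rewrite /odd -/odd negbK => ev.
change (cup (mu k) [seq x + 1 | x <- s] - cup (mu k) s = cup (theta k) s).
have {}IH s' := IH s' ev; move: (mu k) (theta k) IH => m th IH.
case: s => [|x [|y [|z s]]]; try exact: subrr.
by rewrite [cup th _]/cup -IH /cup /map carry2_add1; ring.
Qed.

Lemma mu_odd k s : odd k ->
  \sum_(n < q.+2) mu k [seq x + n%:R | x <- s] = theta k s.
Proof.
elim/nat_ind2: k s => [||k IH] s //.
  by case: s => [|x [|y [|z s]]] //= _; rewrite ?sum_carry // big1.
rewrite /odd -/odd negbK => ev.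
change (\sum_(n < q.+2) cup (mu k) [seq x + n%:R | x <- s] = cup (theta k) s).
have {}IH s' := IH s' ev; move: (mu k) (theta k) IH => m th IH.
case: s => [|x [|y [|z s]]]; try exact: big1.
rewrite [cup th _]/cup -IH mulr_sumr.
by apply: eq_bigr => n _; rewrite /cup /map carry2_addn.
Qed.

(** [carry2] and [y - x] vanish on repeated adjacent labels, so a nonzero value certifies
    alternation. *)
Lemma theta_sorted k s : theta k s != 0 -> sorted (fun x y => x != y) s.
Proof.
elim/nat_ind2: k s => [||k IH] s /=.
- by case: s => [|x [|y s]] //=; rewrite eqxx.
- case: s => [|x [|y [|z s]]] //=; rewrite ?eqxx // andbT.
  by apply: contraNneq => ->; rewrite subrr.
- case: s => [|x [|y [|z s]]] //=; rewrite ?eqxx // => nz.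
  have -> : x != y.
    by apply: contraNneq nz => ->; rewrite /carry2 carryxx; apply/eqP; ring.
  have -> : y != z.
    by apply: contraNneq nz => ->; rewrite /carry2 carryxx; apply/eqP; ring.
  by apply: (IH (z :: s)); apply: contraNneq nz => ->; rewrite mulr0.
Qed.

End CarryCocycle.

(** * The fundamental chain in the poset of signed vectors *)

Section AlternatingFlag.

Variables (q : nat) (I : finType).
Local Notation Z := 'I_q.+2.

Definition vec := {ffun I -> option Z}.
Implicit Types (X Y : vec) (u w : seq vec -> Z) (l : seq I).

Definition vec0 : vec := [ffun=> None].

Definition vrot X : vec := [ffun i => omap (+%R 1) (X i)].

Definition vle X Y := [forall i, (X i == None) || (X i == Y i)].
Definition vlt X Y := vle X Y && (X != Y).

Definition vset (i : I) X : vec := [ffun j => if j == i then Some 0 else X j].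

Lemma vleP X Y : reflect (forall i, X i = None \/ X i = Y i) (vle X Y).
Proof.
apply: (iffP forallP) => XY i; first by case/orP: (XY i) => /eqP; [left|right].
by case: (XY i) => ->; rewrite eqxx ?orbT.
Qed.

Lemma rot0 : vrot vec0 = vec0.
Proof. by apply/ffunP => i; rewrite !ffunE. Qed.

Lemma rot_inj : injective vrot.
Proof.
move=> X Y /ffunP XY; apply/ffunP => i; move: (XY i); rewrite !ffunE.
by case: (X i) (Y i) => [x|] [y|] // /Some_inj/addrI ->.
Qed.

Lemma vle_rot X Y : vle X Y -> vle (vrot X) (vrot Y).
Proof.
by move/vleP=> XY; apply/vleP => i; rewrite !ffunE; case: (XY i) => ->; [left|right].
Qed.

Lemma vlt_rot X Y : vlt X Y -> vlt (vrot X) (vrot Y).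
Proof. by case/andP=> le ne; rewrite /vlt vle_rot ?(inj_eq rot_inj). Qed.

Definition supported l X := [forall i, (X i != None) ==> (i \in l)].

Lemma supportedP l X : reflect (forall i, i \notin l -> X i = None) (supported l X).
Proof.
apply: (iffP forallP) => S i.
  by move=> il; apply/eqP; have := S i; rewrite implyNb (negPf il) orbF.
by rewrite implyNb; case: (boolP (i \in l)) => [|/S ->]; rewrite ?orbT ?eqxx.
Qed.

Definition flag l X s := path vlt X s && all (supported l) s.

Lemma flag_rot l X s n : flag l X s -> flag l (iter n vrot X) (map (iter n vrot) s).
Proof.
move=> /andP[pX /allP sX]; apply/andP; split.
  rewrite path_map; apply: sub_path pX => Y Y' lt; elim: n => //= n; exact: vlt_rot.
apply/allP => _ /mapP[Y Ys ->]; elim: n => [|n IH]; first exact: sX.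
by apply/supportedP => i /(supportedP _ _ IH i) E; rewrite /= ffunE E.
Qed.

Lemma vset_lt l i X Y : supported l X -> supported l Y -> i \notin l ->
  vlt X Y -> vlt (vset i X) (vset i Y).
Proof.
move=> /supportedP sX /supportedP sY il /andP[/vleP le ne]; apply/andP; split.
  by apply/vleP => j; rewrite !ffunE; case: eqP => _; [right | exact: le].
apply: contraNneq ne => /ffunP E; apply/eqP/ffunP => j.
have := E j; rewrite !ffunE; case: eqP => // -> _.
by rewrite sX ?sY.
Qed.

Lemma lt_vset l i X : supported l X -> i \notin l -> vlt X (vset i X).
Proof.
move=> /supportedP sX il; apply/andP; split.
  by apply/vleP => j; rewrite ffunE; case: eqP => [->|]; [left; exact: sX | right].
by apply/negP => /eqP/ffunP/(_ i); rewrite ffunE eqxx sX.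
Qed.

Lemma supported_vset l i X : supported l X -> supported (i :: l) (vset i X).
Proof.
move=> /supportedP sX; apply/supportedP => j; rewrite inE negb_or => /andP[ji jl].
by rewrite ffunE (negPf ji) sX.
Qed.

Lemma supportedW l i X : supported l X -> supported (i :: l) X.
Proof.
move=> /supportedP sX; apply/supportedP => j; rewrite inE negb_or => /andP[_]; exact: sX.
Qed.

(** The cone sends flags to flags: [vset i] is monotone on vectors vanishing at [i] and moves each
    of them upwards. *)
Lemma eq_ins_flag l i X s u w : i \notin l -> supported l X -> flag l X s ->
  (forall s', flag (i :: l) X s' -> size s' = (size s).+1 -> u s' = w s') ->
  ins (vset i) X u s = ins (vset i) X w s.
Proof.
move=> il; elim: s X u w => [|Y s IH] X u w sX fs uw /=.
  by rewrite uw // /flag /= (lt_vset sX il) supported_vset.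
have /andP[pXs /= /andP[sY alls]] := fs; have /andP[XY pY] := pXs.
congr (_ - _).
  apply: uw; last by rewrite /= size_map.
  rewrite /flag /= (lt_vset sX il) (vset_lt sX sY) //= !supported_vset //=.
  apply/andP; split; last first.
    by rewrite all_map; apply: sub_all alls => Z sZ /=; exact: supported_vset.
  elim: s Y pY sY alls {IH fs pXs XY} => //= Z s IHs Y /andP[YZ pZ] sY /andP[sZ alls].
  by rewrite (vset_lt sY sZ) //= IHs.
apply: IH => //; first exact/andP.
move=> s' /andP[pYs' alls'] szs'; apply: uw; last by rewrite /= szs'.
by rewrite /flag /= XY pYs' supportedW.
Qed.

(* The differentials of the periodic resolution of Z/p over its group ring:
   vrot - 1 in odd degrees, the norm in positive even degrees. *)
Definition twist (k : nat) u (s : seq vec) : Z :=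
  if k == 0%N then u s
  else if odd k then u (map vrot s) - u s
  else \sum_(n < q.+2) u (map (iter n vrot) s).

Lemma eq_twist l k u w s :
  (forall s', flag l vec0 s' -> size s' = size s -> u s' = w s') ->
  flag l vec0 s -> twist k u s = twist k w s.
Proof.
move=> uw fs; rewrite /twist.
have E n : u (map (iter n vrot) s) = w (map (iter n vrot) s).
  apply: uw; last by rewrite size_map.
  have := flag_rot n fs; suff -> : iter n vrot vec0 = vec0 by [].
  by elim: n => //= n ->; exact: rot0.
case: ifP => _; first exact: uw.
case: ifP => _; last exact: eq_bigr.
by rewrite (E 1%N) uw.
Qed.

Lemma twistB k u w s : twist k (fun s' => u s' - w s') s = twist k u s - twist k w s.
Proof.
rewrite /twist; case: ifP => // _; case: ifP => _; first by ring.
by rewrite sumrB.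
Qed.

Lemma twist_delta k u s : twist k (delta u) s = delta (twist k u) s.
Proof.
rewrite /twist; case: ifP => // _; case: ifP => _.
  by rewrite deltaB delta_map.
by rewrite delta_sum; apply: eq_bigr => n _; rewrite delta_map.
Qed.

Lemma iter_rot_char X : iter q.+2 vrot X = X.
Proof.
apply/ffunP => i; have E n : iter n vrot X i = omap (+%R n%:R) (X i).
  elim: n => [|n IH]; first by case: (X i) => //= x; rewrite add0r.
  by rewrite /= ffunE IH; case: (X i) => //= x; rewrite addrA nat1r.
by rewrite E; case: (X i) => //= x; rewrite Zp_charE add0r.
Qed.

(** The orbit sum telescopes because [vrot] iterated [q.+2] times is the identity. Degree 0 is
    excluded, [twist 0] being the identity and not the norm. *)
Lemma twistK k u s : (0 < k)%N -> twist k (twist k.+1 u) s = 0.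
Proof.
case: k => // k _; rewrite /twist /= negbK.
have tele : \sum_(n < q.+2) (u (map (iter n.+1 vrot) s) - u (map (iter n vrot) s)) = 0.
  rewrite -(big_mkord xpredT (fun n => u (map (iter n.+1 vrot) s) - u (map (iter n vrot) s))).
  rewrite telescope_sumr // (eq_map iter_rot_char) (eq_map (_ : iter 0 vrot =1 id)) //.
  by rewrite subrr.
case: (odd k) => /=.
  rewrite -[RHS]tele; apply: eq_bigr => n _; congr (u _ - u _).
  by rewrite -map_comp; apply: eq_map => X.
rewrite -sumrB -[RHS]tele; apply: eq_bigr => n _; congr (u _ - u _).
by rewrite -map_comp; apply: eq_map => X /=; rewrite -iterSr.
Qed.

(** Evaluation on a chain: starting from the empty simplex, apply the differential of degree
    [size l'] to the chain of [l'], then cone with [vset i]. *)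
Fixpoint fundamental l u : Z :=
  if l is i :: l' then
    fundamental l' (twist (size l') (ins (vset i) vec0 u))
  else u [::].

(** Twisting and coning preserve flags, so only maximal flags supported on [l] occur in the
    chain. *)
Lemma eq_fundamental l u w : uniq l ->
  (forall s, flag l vec0 s -> size s = size l -> u s = w s) ->
  fundamental l u = fundamental l w.
Proof.
elim: l u w => [|i l IH] u w /=; first by move=> _ uw; apply: uw.
move=> /andP[il ul] uw; apply: IH => // s fs szs; apply: eq_twist fs => s' fs' szs'.
apply: eq_ins_flag fs' _ => //; first by apply/supportedP => j; rewrite ffunE.
by move=> s'' fs'' szs''; apply: uw; rewrite // szs'' szs' szs.
Qed.

Lemma fundamentalB l u w :
  uniq l -> fundamental l (fun s => u s - w s) = fundamental l u - fundamental l w.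
Proof.
elim: l u w => //= i l IH u w /andP[_ ul]; rewrite -IH //.
apply: eq_fundamental => // s fs _; rewrite -twistB.
by apply: eq_twist fs => s' _ _; rewrite insB.
Qed.

(** The boundary of a cone over a cycle is that cycle. *)
Lemma fundamental_delta l i u : uniq l -> i \notin l ->
  (forall w, fundamental l (delta (twist (size l) w)) = 0) ->
  fundamental (i :: l) (delta u) = fundamental l (twist (size l) u).
Proof.
move=> ul il cyc; rewrite -[RHS]subr0 -(cyc (ins (vset i) vec0 u)) -fundamentalB //=.
apply: eq_fundamental => // s fs _; rewrite -twist_delta -twistB.
by apply: eq_twist fs => s' _ _; rewrite -[in RHS](ins_delta (vset i) vec0 u s') addrK.
Qed.

Lemma fundamental_cycle l u : uniq l -> fundamental l (delta (twist (size l) u)) = 0.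
Proof.
elim: l u => [|i l IH] u // /andP[il ul].
rewrite fundamental_delta //; last by move=> w; exact: IH.
(* [twistK] needs positive degree; here only the empty simplex is left, which [vrot] fixes. *)
case: l {IH il} ul => [|j l] ul; first by rewrite /twist /= subrr.
(* The zero cochain is written as a difference so that [fundamentalB] evaluates it. *)
rewrite (eq_fundamental (w := fun s => 0 - 0)) // => [|s _ _]; last by rewrite twistK ?subrr.
by rewrite (fundamentalB (fun=> 0) (fun=> 0)) // subrr.
Qed.

Variable sgn : vec -> Z.
Hypothesis sgn_rot : forall X, X != vec0 -> sgn (vrot X) = sgn X + 1.

Definition pullback (f : seq Z -> Z) (s : seq vec) := f (map sgn s).

Lemma vlt_neq0 X Y : vlt X Y -> Y != vec0.
Proof.
case/andP=> /vleP le; apply: contraNneq => Y0; apply/eqP/ffunP => i.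
by case: (le i) => // ->; rewrite Y0 ffunE.
Qed.

Lemma flag_neq0 l s : flag l vec0 s -> {in s, forall X, X != vec0}.
Proof.
case/andP=> + _; elim: s {1}vec0 => [|Y s IH] X0 // /andP[/vlt_neq0 Y0 /IH h] X.
by rewrite inE => /predU1P[->|/h].
Qed.

Lemma sgn_iter n X : X != vec0 -> sgn (iter n vrot X) = sgn X + n%:R.
Proof.
move=> X0; have n0 : iter n vrot X != vec0.
  by elim: n => //= n IH; rewrite -rot0 (inj_eq rot_inj).
elim: n n0 => [|n IH] n0; first by rewrite addr0.
have n0' : iter n vrot X != vec0 by apply: contraNneq n0 => /= ->; rewrite rot0.
by rewrite /= sgn_rot // IH // -addrA natr1.
Qed.

Lemma twist_mu k l s : flag l vec0 s ->
  twist k.+1 (pullback (mu k)) s = pullback (theta k) s.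
Proof.
move=> /flag_neq0 s0; rewrite /twist [odd k.+1]/= /pullback.
have E n : map sgn (map (iter n vrot) s) = [seq x + n%:R | x <- map sgn s].
  by rewrite -!map_comp; apply/eq_in_map => X /s0 X0; exact: sgn_iter.
case: ifP => [ev|/negbFE od] /=; first by rewrite -mu_even // -(E 1%N).
by rewrite -mu_odd //; apply: eq_bigr => n _; rewrite E.
Qed.

(** Stokes: [theta k.+1] is [delta (mu k)], the boundary is the twisted shorter chain, and twisting
    [mu k] gives [theta k]. The value descends unchanged to a single vertex, where it is 1. *)
Lemma fundamental_theta l : uniq l -> (0 < size l)%N ->
  fundamental l (pullback (theta (size l).-1)) = 1.
Proof.
elim: l => // i l IH /andP[il ul] _.
case: l il ul IH => [|j l'] il ul IH; first by rewrite /= /twist /= subr0.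
rewrite -(IH ul isT); set l := j :: l' in il ul *.
transitivity (fundamental (i :: l) (delta (pullback (mu (size l'))))).
  apply: eq_fundamental; first exact/andP.
  by move=> s _ _; rewrite /pullback -delta_map delta_mu.
rewrite fundamental_delta // => [|w]; last exact: fundamental_cycle.
by apply: eq_fundamental => // s fs _; exact: twist_mu fs.
Qed.

(** Without an alternating maximal flag the cocycle would vanish on the whole chain, against its
    value 1. *)
Lemma alternating_flag : (0 < #|I|)%N ->
  exists s : seq vec, [/\ size s = #|I|, path vlt vec0 s &
    sorted (fun x y => x != y) (map sgn s)].
Proof.
move=> I0; suff /existsP[s /andP[ps ss]] : [exists s : #|I|.-tuple vec,
    path vlt vec0 s && sorted (fun x y => x != y) (map sgn s)].
  by exists s; rewrite size_tuple.
apply: contraT => /existsPn none.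
have szI : size (enum I) = #|I| by rewrite cardE.
have := @fundamental_theta (enum I) (enum_uniq I); rewrite szI => /(_ I0).
rewrite (eq_fundamental (w := fun s => 0 - 0)) ?enum_uniq //; last first.
  move=> s /andP[ps _] /eqP szs; rewrite subrr; apply/eqP; apply: contraT => /theta_sorted ss.
  by rewrite szI in szs; have := none (Tuple szs); rewrite /= ps ss.
by rewrite (fundamentalB (fun=> 0) (fun=> 0)) ?enum_uniq // subrr.
Qed.

(** Along an alternating flag the level rises strictly, since equal levels would force equal
    signs. *)
Theorem level_bound (L : vec -> nat) : (0 < #|I|)%N ->
  (forall X, X != vec0 -> (0 < L X)%N) ->
  (forall X Y, X != vec0 -> vle X Y -> (L X <= L Y)%N) ->
  (forall X Y, X != vec0 -> vle X Y -> L X = L Y -> sgn X = sgn Y) ->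
  exists2 X, X != vec0 & (#|I| <= L X)%N.
Proof.
move=> I0 L0 Lle Lsgn; have [s [szs ps ss]] := alternating_flag I0; rewrite -szs in I0 *.
have climb X s' : X != vec0 -> path vlt X s' ->
    sorted (fun x y => x != y) (map sgn (X :: s')) ->
    exists2 Y, Y != vec0 & (L X + size s' <= L Y)%N.
  elim: s' X => [|Y s' IH] X X0 /=; first by exists X; rewrite ?addn0.
  case/andP=> lt pY /andP[XY sY]; have [Z Z0 le] := IH Y (vlt_neq0 lt) pY sY.
  exists Z => //; apply: leq_trans le; rewrite -addSnnS leq_add2r ltn_neqAle.
  have /andP[le _] := lt; rewrite Lle // andbT.
  by apply: contraNneq XY => /(Lsgn _ _ X0 le) ->.
case: s I0 ps ss {szs} => [|X s] //= _.
case/andP=> /vlt_neq0 X0 ps ss; have [Y Y0 le] := climb X s X0 ps ss.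
by exists Y => //; apply: leq_trans le; rewrite -add1n leq_add2r L0.
Qed.

End AlternatingFlag.

(** * Block levels *)

Section Average.

Variable q : nat.
Hypothesis p_prime : prime q.+2.
Local Notation Z := 'I_q.+2.

(* Averaging is the equivariant choice of an element of Z/p attached to a proper
   nonempty subset; it makes sense because the cardinal is invertible mod p. *)
Definition average (S : {set Z}) : Z := (\sum_(x in S) x) / #|S|%:R.

Lemma average_rot (S : {set Z}) : (0 < #|S| < q.+2)%N ->
  average [set 1 + x | x in S] = average S + 1.
Proof.
move=> /andP[S0 Sp]; have unitS : (#|S|%:R : Z) \is a GRing.unit.
  rewrite (@unitZpE q.+2) // prime_coprime // gtnNdvd //.
rewrite /average card_imset; last exact: addrI.
rewrite big_imset /=; last by move=> x y _ _; apply: addrI.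
by rewrite big_split /= sumr_const mulrDl mulrV // addrC.
Qed.

End Average.

(** * Alternation under extension of signed vectors *)

Section Alternation.

Variables (p n : nat).
Implicit Types (X Y : signed_vector p n) (w : seq (option 'I_p)).

Definition tle X Y := forall i, tnth X i = None \/ tnth X i = tnth Y i.

Definition tsupp X : {set 'I_n} := [set i | tnth X i != None].

Definition tsize X : nat := #|tsupp X|.

Definition nonzero X := [seq x <- X | isSome x].

Lemma size_nonzero X : size (nonzero X) = tsize X.
Proof.
rewrite size_filter -sum1_count big_tuple /tsize -sum1_card.
by apply: eq_bigl => i; rewrite inE; case: (tnth X i).
Qed.

Lemma tle_tsupp X Y : tle X Y -> tsupp X \subset tsupp Y.
Proof.
by move=> XY; apply/subsetP => i; rewrite !inE; case: (XY i) => ->; rewrite ?eqxx.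
Qed.

Lemma tle_tsize X Y : tle X Y -> (tsize X <= tsize Y)%N.
Proof. by move=> XY; apply/subset_leq_card/tle_tsupp. Qed.

Lemma tsize_gt0 X : (0 < tsize X)%N = (tsupp X != set0).
Proof. exact: card_gt0. Qed.

Lemma tle_card_eq X Y : tle X Y -> (tsize Y <= tsize X)%N -> X = Y.
Proof.
move=> XY le; have /eqP E : tsupp X == tsupp Y by rewrite eqEcard tle_tsupp.
apply: eq_from_tnth => i; case: (XY i) => // Xi.
have : i \notin tsupp Y by rewrite -E inE Xi eqxx.
by rewrite inE negbK Xi => /eqP.
Qed.

Lemma alt_ge X w : subseq w X -> alternating w -> (size w <= alt X)%N.
Proof.
case/subseqP=> m /eqP szm -> aw; rewrite size_tuple in szm.
exact: (@leq_bigmax_cond _ _ (fun m : n.-tuple bool => size (mask m X)) (Tuple szm)).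
Qed.

Lemma alt_witness X : exists w, [/\ subseq w X, alternating w & size w = alt X].
Proof.
have alt0 : alternating (mask (nseq_tuple n false) X) by rewrite mask_false.
rewrite /alt (bigop.bigmax_eq_arg (nseq_tuple n false)) //.
case: arg_maxnP => // m am _; exists (mask m X); split=> //; exact: mask_subseq.
Qed.

Lemma subseq_nonzero X w : alternating w -> subseq w X = subseq w (nonzero X).
Proof. by case/andP=> Sw _; rewrite subseq_filter Sw. Qed.

Lemma tle_subseq X Y w : tle X Y -> alternating w -> subseq w X -> subseq w Y.
Proof.
move=> XY /andP[Sw _].
have {}XY i : nth None X i = None \/ nth None X i = nth None Y i.
  case: (ltnP i n) => [lt|ge]; last by left; rewrite nth_default ?size_tuple.
  by have := XY (Ordinal lt); rewrite !(tnth_nth None).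
have: size X = size Y by rewrite !size_tuple.
elim: {X}(tval X) {Y}(tval Y) w Sw XY => [|x X IH] [|y Y] //= [|b w] //= /andP[Sb Sw] XY [sz].
have XY' i := XY i.+1; have := XY 0%N => /= xy.
case: eqP => [E|_] sub.
  by case: xy => [x0|<-]; [move: Sb; rewrite E x0 | rewrite E eqxx; exact: (IH Y)].
have subY : subseq (b :: w) Y by apply: IH => //=; rewrite Sb.
exact: (@subseq_trans _ Y (b :: w) (y :: Y) subY (subseq_cons Y y)).
Qed.

Lemma alt_le X Y : tle X Y -> (alt X <= alt Y)%N.
Proof.
move=> XY; have [w [sub aw <-]] := alt_witness X.
exact: alt_ge (tle_subseq XY aw sub) aw.
Qed.

Lemma alt_tsize X : (alt X <= tsize X)%N.
Proof.
have [w [sub aw <-]] := alt_witness X; rewrite subseq_nonzero // in sub.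
by rewrite -size_nonzero size_subseq.
Qed.

Lemma alternating_cons a w :
  alternating (Some a :: w) = (ohead w != Some (Some a)) && alternating w.
Proof.
rewrite /alternating /=; case: w => //= b w.
by rewrite andbCA eq_sym.
Qed.

Lemma alt_gt0 X : tsupp X != set0 -> (0 < alt X)%N.
Proof.
rewrite -tsize_gt0 -size_nonzero; case E: (nonzero X) => [|b w] // _.
have : all isSome (nonzero X) by exact: filter_all.
rewrite E /= => /andP[Sb _]; apply: (@alt_ge X [:: b]); last by rewrite /alternating /= Sb.
by rewrite (subseq_trans _ (filter_subseq isSome X)) // -/(nonzero X) E sub1seq mem_head.
Qed.

Definition first X : option 'I_p := head None (nonzero X).

(** A longest alternating subsequence starts with the first nonzero label, which could otherwise be
    prepended. One for [X] is still longest in [Y]. *)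
Lemma first_eq X Y : tle X Y -> tsupp X != set0 -> alt X = alt Y -> first X = first Y.
Proof.
move=> XY X0 eqalt; rewrite /first.
have [w [sub aw szw]] := alt_witness X.
have subY := tle_subseq XY aw sub.
rewrite (subseq_nonzero _ aw) in sub; rewrite (subseq_nonzero _ aw) in subY.
have longer Y' a r : nonzero Y' = a :: r -> subseq w (nonzero Y') -> alt X = alt Y' ->
    head None w = a.
  move=> E sY' eqY'; case: w aw szw sY' {sub subY} => [|b w] aw szw.
    by move: (alt_gt0 X0); rewrite -szw.
  rewrite E /=; case: eqP => // ba sY'.
  have : all isSome (nonzero Y') by exact: filter_all.
  rewrite E; case: a E ba => [a|] // E ba _.
  have aaw : alternating (Some a :: b :: w).
    by rewrite alternating_cons aw andbT; apply: contra_notN ba => /eqP[].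
  have : (size (Some a :: b :: w) <= alt Y')%N.
    by apply: (alt_ge _ aaw); rewrite subseq_nonzero // E /= eqxx.
  by rewrite -eqY' -szw /= ltnn.
case EX: (nonzero X) => [|a r].
  by move: X0; rewrite -tsize_gt0 -size_nonzero EX.
case EY: (nonzero Y) => [|b r'].
  by move: aw szw subY; rewrite EY => _ szw /eqP w0; move: (alt_gt0 X0); rewrite -szw w0.
by rewrite /= -(longer X a r) // -(longer Y b r').
Qed.

End Alternation.

(** * Rotation of labels *)

Section Rotation.

Variables (q n : nat).
Local Notation Z := 'I_q.+2.
Implicit Types X Y : signed_vector q.+2 n.

Definition trot X : signed_vector q.+2 n := map_tuple (omap (+%R 1)) X.

Lemma tnth_trot X i : tnth (trot X) i = omap (+%R 1) (tnth X i).
Proof. exact: tnth_map. Qed.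

Lemma omap_add1_inj : injective (omap (+%R (1 : Z))).
Proof. by move=> [x|] [y|] // /Some_inj/addrI ->. Qed.

Lemma alternating_add1 (w : seq (option Z)) :
  alternating (map (omap (+%R 1)) w) = alternating w.
Proof.
rewrite /alternating all_map sorted_map; congr (_ && _).
  by apply: eq_all => -[].
by case: w => //= x w; apply: eq_path => a b /=; rewrite (inj_eq omap_add1_inj).
Qed.

Lemma alt_rot X : alt (trot X) = alt X.
Proof.
apply: eq_big => [m|m _]; first by rewrite -map_mask alternating_add1.
by rewrite -map_mask size_map.
Qed.

Lemma tsupp_rot X : tsupp (trot X) = tsupp X.
Proof. by apply/setP => i; rewrite !inE tnth_trot; case: (tnth X i). Qed.

Lemma tsize_rot X : tsize (trot X) = tsize X.
Proof. by rewrite /tsize tsupp_rot. Qed.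

Definition firstsgn X : Z := odflt 0 (first X).

Lemma firstsgn_rot X : tsupp X != set0 -> firstsgn (trot X) = firstsgn X + 1.
Proof.
have E : nonzero (trot X) = map (omap (+%R 1)) (nonzero X).
  by rewrite /nonzero filter_map; congr map; apply: eq_filter; case.
rewrite /firstsgn /first E -tsize_gt0 -size_nonzero.
have : all isSome (nonzero X) by exact: filter_all.
by case: (nonzero X) => [|[x|] w] // _ _; rewrite [RHS]addrC.
Qed.

Lemma label_class_rot X e : label_class (trot X) (1 + e) = label_class X e.
Proof.
apply/setP => i; rewrite !inE tnth_trot.
by rewrite -[Some (1 + e)]/(omap (+%R 1) (Some e)) (inj_eq omap_add1_inj).
Qed.

End Rotation.

(** * Level and sign of a block *)

Section BlockLevel.

Variables (q : nat) (H : hypergraph) (s : ordering H) (a : nat).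
Local Notation Z := 'I_q.+2.
Local Notation n := #|vertex H|.
Implicit Types X Y : signed_vector q.+2 n.
Hypothesis alt_edge_free : forall X, edge_free s X -> (alt X <= a)%N.

Definition edge_labels X : {set Z} :=
  [set eps | [exists A in hyperedges H, A \subset s @: label_class X eps]].

Definition nlabels X : nat := #|edge_labels X|.

Lemma edge_labels_le X Y : tle X Y -> edge_labels X \subset edge_labels Y.
Proof.
move=> XY; apply/subsetP => e; rewrite !inE => /existsP[A /andP[HA sub]].
apply/existsP; exists A; rewrite HA (subset_trans sub) //; apply: imsetS.
by apply/subsetP => i; rewrite !inE; case: (XY i) => ->.
Qed.

Lemma nlabels_le X Y : tle X Y -> (nlabels X <= nlabels Y)%N.
Proof. by move=> XY; apply/subset_leq_card/edge_labels_le. Qed.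

Lemma edge_labels_rot X : edge_labels (trot X) = [set 1 + e | e in edge_labels X].
Proof.
apply/setP => e; rewrite -(addrNK 1 e) addrC mem_imset; last exact: addrI.
by rewrite !inE label_class_rot.
Qed.

Lemma nlabels_rot X : nlabels (trot X) = nlabels X.
Proof. by rewrite /nlabels edge_labels_rot card_imset //; exact: addrI. Qed.

Lemma nlabels_gt0 X : (a < alt X)%N -> (0 < nlabels X)%N.
Proof.
rewrite ltnNge; apply: contraR; rewrite /nlabels card_gt0 negbK => /eqP S0.
apply: alt_edge_free; apply/existsPn => e; apply: contraTN isT => He.
by have := in_set0 e; rewrite -S0 inE He.
Qed.

Definition excess X := minn (nlabels X) (tsize X - a).

Definition full_block X := (a < alt X)%N && (q.+2 <= excess X)%N.

Definition block_level X : nat :=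
  if (alt X <= a)%N then alt X
  else if (excess X < q.+2)%N then (a + excess X)%N else tsize X.

(** The label set is averaged where it is proper and its size realizes the minimum [excess].
    Elsewhere, comparable vectors of equal level are settled by [first_eq] or coincide. *)
Definition block_sgn X : Z :=
  if [&& (a < alt X)%N, (nlabels X < q.+2)%N &
      (nlabels X <= tsize X - a)%N]
  then average (edge_labels X) else firstsgn X.

Lemma excess_gt0 X : (a < alt X)%N -> (0 < excess X)%N.
Proof.
move=> aX; rewrite leq_min nlabels_gt0 // subn_gt0.
exact: leq_trans aX (alt_tsize X).
Qed.

Lemma excess_le X Y : tle X Y -> (excess X <= excess Y)%N.
Proof.
move=> XY; have := nlabels_le XY.
by have := tle_tsize XY; rewrite /excess; lia.
Qed.

Lemma block_level_tsize X : (block_level X <= tsize X)%N.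
Proof.
have := alt_tsize X; rewrite /block_level /excess.
by case: (leqP (alt X) a) => // aX; case: ifP => // _; lia.
Qed.

Lemma block_level_gt0 X : tsupp X != set0 -> (0 < block_level X)%N.
Proof.
move=> X0; rewrite /block_level; case: (leqP (alt X) a) => [_|aX]; first exact: alt_gt0.
case: ifP => _; first by have := excess_gt0 aX; lia.
by rewrite tsize_gt0.
Qed.

Lemma block_level_not_full X : ~~ full_block X -> (block_level X <= a + q.+1)%N.
Proof. by rewrite /full_block /block_level; case: (leqP (alt X) a) => /= aX;
  case: (ltnP (excess X) q.+2); lia. Qed.

(** Passing from one regime of the level to the next raises it strictly. Within a regime above [a],
    comparable vectors of equal size coincide, so only growth of the size is delicate. *)
Lemma block_level_mono X Y : tle X Y -> (block_level X <= block_level Y)%N /\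
  (tsupp X != set0 -> block_level X = block_level Y -> block_sgn X = block_sgn Y).
Proof.
move=> XY; have altXY := alt_le XY; have excXY := excess_le XY.
have sX := alt_tsize X; have sY := alt_tsize Y.
have sXY := tle_tsize XY.
have lXY := nlabels_le XY.
have eqXY : (tsize Y <= tsize X)%N -> block_sgn X = block_sgn Y.
  by move=> le; rewrite (tle_card_eq XY le).
rewrite /block_level /block_sgn; case: (leqP (alt X) a) => aX /=.
  case: (leqP (alt Y) a) => aY /=.
    by split=> // X0 /(first_eq XY X0); rewrite /firstsgn => ->.
  set lY := if (excess Y < q.+2)%N then _ else _.
  have lt : (alt X < lY)%N.
    apply: leq_ltn_trans aX _; rewrite /lY; case: ifP => _; last exact: leq_trans sY.
    by rewrite -addn1 leq_add2l excess_gt0.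
  by split=> [|_ E]; [exact: ltnW | move: lt; rewrite E ltnn].
have aY : (a < alt Y)%N by exact: leq_trans aX altXY.
rewrite [(alt Y <= a)%N]leqNgt aY /=.
have := eqXY; rewrite /block_sgn aX aY /= => {}eqXY.
have [eX|eX] := ltnP (excess X) q.+2; have [eY|eY] := ltnP (excess Y) q.+2.
- split=> [|_ /eqP]; rewrite ?leq_add2l // eqn_add2l => /eqP eqe.
  have [le|gt] := leqP (tsize Y) (tsize X); first exact: eqXY.
  (* The size grows but the minimum does not, so in both vectors the minimum is the number of
     labels, and the nested label sets agree. *)
  have lX : nlabels X = excess X by move: eqe gt; rewrite /excess; lia.
  have lY : nlabels Y = excess X by move: eqe gt lX; rewrite /excess; lia.
  have SE : edge_labels X = edge_labels Y.
    apply/eqP; rewrite eqEcard edge_labels_le //=.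
    by change (nlabels Y <= nlabels X)%N; rewrite lX lY.
  rewrite -SE lX lY eX /=.
  have -> : (excess X <= tsize X - a)%N by rewrite /excess; lia.
  by have -> : (excess X <= tsize Y - a)%N by rewrite /excess; lia.
- have lt : (a + excess X < tsize Y)%N.
    move: eY; rewrite leq_min ltn_subRL => /andP[_]; apply: leq_ltn_trans.
    by rewrite leq_add2l.
  by split=> [|_ E]; [exact: ltnW | move: lt; rewrite E ltnn].
- by move: (leq_trans eX excXY); rewrite leqNgt eY.
- by split=> // _ E; apply: eqXY; rewrite E.
Qed.

Lemma full_block_rot X : full_block (trot X) = full_block X.
Proof.
by rewrite /full_block /excess alt_rot tsize_rot nlabels_rot.
Qed.

Lemma full_block_le X Y : tle X Y -> full_block X -> full_block Y.
Proof.
move=> XY /andP[aX eX]; rewrite /full_block (leq_trans aX) ?alt_le //=.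
exact: leq_trans (excess_le XY).
Qed.

Lemma full_block_labels X e : full_block X ->
  exists2 A, A \in hyperedges H & A \subset s @: label_class X e.
Proof.
case/andP=> _; rewrite leq_min => /andP[le _].
have /eqP S : edge_labels X == setT by rewrite eqEcard subsetT cardsT card_ord.
have : e \in edge_labels X by rewrite S inE.
by rewrite inE => /existsP[A /andP[? ?]]; exists A.
Qed.

Hypothesis p_prime : prime q.+2.

Lemma block_sgn_rot X : tsupp X != set0 -> block_sgn (trot X) = block_sgn X + 1.
Proof.
move=> X0; rewrite /block_sgn alt_rot tsize_rot nlabels_rot edge_labels_rot.
case: ifP => [/and3P[aX lX _]|_]; last exact: firstsgn_rot.
by rewrite average_rot // [#|_|]/(nlabels X) nlabels_gt0.
Qed.

End BlockLevel.

(** * Balanced families of colors *)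

Lemma exists_subset_card (T : finType) (A : {set T}) k : (k <= #|A|)%N ->
  exists2 B : {set T}, B \subset A & #|B| = k.
Proof.
case/card_geqP=> s [us <- sA]; exists [set x in s].
  by apply/subsetP => x; rewrite inE; exact: sA.
by rewrite cardsE; exact/card_uniqP.
Qed.

Section Balanced.

Variables (q : nat) (K : finType).
Local Notation Z := 'I_q.+2.
Implicit Types tau : Z -> {set K}.

Definition low tau : nat := #|tau [arg min_(e < 0) #|tau e|]|.

Definition high tau : {set Z} := [set e | (low tau < #|tau e|)%N].

(* The largest number of elements of a balanced subfamily of tau. *)
Definition balance tau : nat := (q.+2 * low tau + #|high tau|)%N.

Lemma low_min tau e : (low tau <= #|tau e|)%N.
Proof. by rewrite /low; case: arg_minnP => // i _; apply. Qed.

Lemma le_low tau m : (forall e, (m <= #|tau e|)%N) -> (m <= low tau)%N.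
Proof. exact. Qed.

Lemma card_high tau : (#|high tau| < q.+2)%N.
Proof.
rewrite -[ltnRHS]card_ord -cardsT; apply: proper_card; rewrite properE subsetT /=.
apply/subsetPn; exists [arg min_(e < 0) #|tau e|]; first by rewrite inE.
by rewrite inE ltnn.
Qed.

Lemma balance_low tau : (q.+2 * low tau <= balance tau)%N.
Proof. exact: leq_addr. Qed.

Section Monotone.

Variables tau1 tau2 : Z -> {set K}.
Hypothesis sub12 : forall e, tau1 e \subset tau2 e.

Lemma low_sub : (low tau1 <= low tau2)%N.
Proof.
by apply: le_low => e; apply: leq_trans (subset_leq_card (sub12 e)); exact: low_min.
Qed.

Lemma high_sub : low tau1 = low tau2 -> high tau1 \subset high tau2.
Proof.
move=> E; apply/subsetP => e; rewrite !inE -E => /leq_trans; apply.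
exact: subset_leq_card.
Qed.

(** Fewer than [q.+2] labels are high, so [low] and [#|high|] are the quotient and remainder of
    [balance] by [q.+2], and comparison is lexicographic. *)
Lemma balance_sub : (balance tau1 <= balance tau2)%N.
Proof.
have := low_sub; rewrite leq_eqVlt => /predU1P[E|lt].
  by rewrite /balance E leq_add2l subset_leq_card // high_sub.
apply: leq_trans (balance_low tau2).
apply: (@leq_trans (q.+2 * (low tau1).+1)); last by rewrite leq_mul2l lt orbT.
by rewrite mulnS /balance addnC leq_add2r ltnW // card_high.
Qed.

(** Without high labels all the sets have exactly [low] elements, which turns inclusions into
    equalities. *)
Lemma balance_eq : balance tau1 = balance tau2 ->
  high tau1 = high tau2 /\ (high tau1 = set0 -> tau1 =1 tau2).
Proof.
move=> E; have El : low tau1 = low tau2.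
  have := congr1 (divn^~ q.+2) E; rewrite /= /balance !(mulnC q.+2).
  by rewrite !divnMDl // !divn_small ?card_high // !addn0.
have Eh : high tau1 = high tau2.
  apply/eqP; rewrite eqEcard high_sub //=.
  by move: E; rewrite /balance El => /addnI ->.
split=> // h0 e; apply/eqP; rewrite eqEcard sub12 /=.
have : e \notin high tau2 by rewrite -Eh h0 inE.
by rewrite inE -leqNgt -El => /leq_trans; apply; exact: low_min.
Qed.

End Monotone.

(** When all sizes agree, [high] is empty and cannot be averaged equivariantly; the labels carrying
    one chosen color replace it, a proper subset if no color occurs everywhere. *)
Definition balance_sgn tau : Z :=
  if high tau != set0 then average (high tau)
  else if [pick k | [exists e, k \in tau e]] is Some k
       then average [set e | k \in tau e] else 0.

Lemma eq_balance_sgn tau1 tau2 : (forall e, tau1 e \subset tau2 e) ->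
  balance tau1 = balance tau2 -> balance_sgn tau1 = balance_sgn tau2.
Proof.
move=> sub /(balance_eq sub)[Eh Et]; rewrite /balance_sgn -Eh.
case: eqP => //= /Et {}Et.
rewrite (eq_pick (Q := fun k => [exists e, k \in tau2 e])); last first.
  by move=> k; apply: eq_existsb => e; rewrite Et.
by case: pickP => // k _; congr average; apply/setP => e; rewrite !inE Et.
Qed.

Section Rotate.

Hypothesis p_prime : prime q.+2.
Variables tau1 tau2 : Z -> {set K}.
Hypothesis rot12 : forall e, tau2 (1 + e) = tau1 e.

Let rot21 e : tau2 e = tau1 (e - 1).
Proof. by rewrite -rot12 addrC addrNK. Qed.

Lemma low_rot : low tau2 = low tau1.
Proof.
apply/eqP; rewrite eqn_leq; apply/andP; split; apply: le_low => e.
  by rewrite -rot12 low_min.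
by rewrite rot21 low_min.
Qed.

Lemma rot_set (P2 P1 : pred Z) : (forall e, P2 (1 + e) = P1 e) ->
  [set e | P2 e] = [set 1 + e | e in [set e | P1 e]].
Proof.
move=> E; apply/setP => e; rewrite -(addrNK 1 e) addrC mem_imset; last exact: addrI.
by rewrite !inE E.
Qed.

Lemma high_rot : high tau2 = [set 1 + e | e in high tau1].
Proof. by apply: rot_set => e; rewrite rot12 low_rot. Qed.

Lemma balance_sgn_rot : (0 < low tau1)%N ->
  (forall k, exists e, k \notin tau1 e) ->
  balance_sgn tau2 = balance_sgn tau1 + 1.
Proof.
move=> l0 nfull; rewrite /balance_sgn high_rot.
rewrite -!card_gt0 card_imset; last exact: addrI.
case: posnP => [_|h0] /=; last by rewrite average_rot // h0 card_high.
(* The color is picked from the union over all labels, which rotation leaves unchanged. *)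
rewrite (eq_pick (Q := fun k => [exists e, k \in tau1 e])); last first.
  move=> k; apply/existsP/existsP => -[e ke]; first by exists (e - 1); rewrite -rot21.
  by exists (1 + e); rewrite rot12.
case: pickP => [k /existsP[e ke]|none].
  rewrite (rot_set (P1 := fun e => k \in tau1 e)); last by move=> e'; rewrite rot12.
  rewrite average_rot //; apply/andP; split.
    by rewrite card_gt0; apply/set0Pn; exists e; rewrite inE.
  have [e' ke'] := nfull k; rewrite -[ltnRHS]card_ord -cardsT; apply: proper_card.
  by rewrite properE subsetT /=; apply/subsetPn; exists e'; rewrite ?inE.
have := leq_trans l0 (low_min tau1 0); rewrite card_gt0 => /set0Pn[k k0].
by have /existsP[] := none k; exists 0.
Qed.

End Rotate.

(** Divide [m] by [q.+2]: [r] labels get [b + 1] colors, the others [b]. *)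
Lemma balance_sizes tau m : (m <= balance tau)%N ->
  exists k : Z -> nat, [/\ forall e, (k e <= #|tau e|)%N, (\sum_e k e = m)%N &
    forall e e', (k e <= k e' + 1)%N].
Proof.
move=> le; pose b := (m %/ q.+2)%N; pose r := (m %% q.+2)%N.
have mE : m = (b * q.+2 + r)%N by exact: divn_eq.
have r_lt : (r < q.+2)%N by exact: ltn_mod.
have ltU := card_high tau.
have bl : (b <= low tau)%N.
  by rewrite -ltnS -(@ltn_pmul2l q.+2) // mulnS; move: le; rewrite /balance mE; lia.
(* Labels that can afford [b + 1]: the high ones if [b] equals [low], all of them if it is
   smaller. *)
have : (r <= #|[set e | b < #|tau e|]|)%N.
  move: bl; rewrite leq_eqVlt => /predU1P[bE|lt].
    by move: le; rewrite /balance /high -bE mE mulnC leq_add2l.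
  rewrite (_ : [set e | _] = setT) ?cardsT ?card_ord 1?ltnW //.
  by apply/setP => e; rewrite !inE (leq_trans lt) // low_min.
case/exists_subset_card=> B BU cB; exists (fun e => b + (e \in B))%N; split.
- move=> e; case: (boolP (e \in B)) => eB; last by rewrite addn0 (leq_trans bl) ?low_min.
  by have := subsetP BU e eB; rewrite inE addn1.
- rewrite big_split /= sum_nat_const card_ord mE -cB mulnC; congr (_ + _)%N.
  by rewrite -sum1_card [RHS]big_mkcond.
- by move=> e e'; case: (e \in B); case: (e' \in B); lia.
Qed.

End Balanced.

(** * Products of Kneser hypergraphs *)

Section KneserProduct.

Variables (q t : nat) (p_prime : prime q.+2) (t_gt0 : (0 < t)%N) (H : 'I_t -> hypergraph).
Local Notation Z := 'I_q.+2.
Local Notation n j := #|vertex (H j)|.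
Local Notation kneser_product :=
  (categorical_product t_gt0 (fun i => kneser (prime_gt0 p_prime) (H i))).
Local Notation V := (vertex kneser_product).

Definition edge_at (v : V) (j : 'I_t) : {set vertex (H j)} :=
  val (v j : kneser_vertex (H j)).

Lemma edge_at_neq0 v j : edge_at v j != set0.
Proof.
apply: contraNneq (hyperedges_neq0 (H j)) => <-; exact: (valP (v j : kneser_vertex (H j))).
Qed.

(** Disjoint nonempty edges are distinct, so each projection keeps all [q.+2] elements. *)
Lemma disjoint_hyperedge (e : {set V}) : #|e| = q.+2 ->
  {in e &, forall x y, x != y -> forall j, [disjoint edge_at x j & edge_at y j]} ->
  e \in hyperedges kneser_product.
Proof.
move=> card_e dis; rewrite inE; apply/forallP => j; rewrite inE; apply/andP; split.
  rewrite card_in_imset ?card_e // => x y xe ye xy; apply/eqP; apply: contraT => ne.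
  have := dis x y xe ye ne j; rewrite /edge_at xy -setI_eq0 setIid.
  by rewrite (negPf (edge_at_neq0 y j)).
apply/forall_inP => _ /imsetP[x xe ->]; apply/forall_inP => _ /imsetP[y ye ->].
apply/implyP => ne; apply: dis => //; by apply: contraNneq ne => ->.
Qed.

Variables (C : eqType) (c : V -> C).
Hypothesis c_proper : proper_coloring c.

(** [C] may be infinite; a canonical vertex of each color keeps the set of colors in a finite
    type. *)
Definition color_repr (v : V) : V := odflt v [pick w | c w == c v].

Lemma color_reprP v w : (color_repr v == color_repr w) = (c v == c w).
Proof.
have cr u : c (color_repr u) = c u.
  by rewrite /color_repr; case: pickP => [w' /eqP|/(_ u)]; rewrite ?eqxx.
apply/eqP/eqP => [E|E]; first by rewrite -cr E cr.
rewrite /color_repr; under eq_pick => u do rewrite E.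
by case: pickP => // /(_ w); rewrite eqxx.
Qed.

Variables (s : forall j, ordering (H j)) (a : 'I_t -> nat).
Hypothesis s_inj : forall j, injective (s j).
Hypothesis alt_edge_free :
  forall j (X : signed_vector q.+2 (n j)), edge_free (s j) X -> (alt X <= a j)%N.

Definition position : finType := {j : 'I_t & 'I_(n j)}.
Local Notation vec := (vec q position).
Implicit Types X Y : vec.

Definition block X j : signed_vector q.+2 (n j) :=
  [tuple X (Tagged (fun j => 'I_(n j)) i) | i < n j].

Definition members X e : {set V} :=
  [set v : V | [forall j, edge_at v j \subset s j @: label_class (block X j) e]].

Lemma membersP X e v : reflect (forall j, edge_at v j \subset s j @: label_class (block X j) e)
  (v \in members X e).
Proof. by rewrite inE; exact: forallP. Qed.

Lemma members_disjoint X e f v w j : e != f -> v \in members X e -> w \in members X f ->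
  [disjoint edge_at v j & edge_at w j].
Proof.
move=> ef /membersP/(_ j) ve /membersP/(_ j) wf.
apply: disjointWl ve _; apply: disjointWr wf _.
rewrite -setI_eq0 -imsetI; last by move=> x y _ _; apply: s_inj.
rewrite (_ : _ :&: _ = set0) ?imset0 //; apply/setP => i; rewrite !inE.
apply/negP => /andP[/eqP -> /eqP[fe]]; by rewrite fe eqxx in ef.
Qed.

Definition colors X e : {set V} := color_repr @: members X e.

(** Vertices of one color taken at all labels would form a monochromatic hyperedge. *)
Lemma colors_not_full X k : exists e, k \notin colors X e.
Proof.
apply/existsP; apply: contraT => /existsPn full.
have /fin_all_exists[v vP] e : exists v, v \in members X e /\ k = color_repr v.
  by have := full e; rewrite negbK => /imsetP[v]; exists v.
have v_dis e f : e != f -> forall j, [disjoint edge_at (v e) j & edge_at (v f) j].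
  by move=> ef j; exact: members_disjoint ef (vP e).1 (vP f).1.
have v_inj : injective v.
  move=> e f E; apply/eqP; apply: contraT => /v_dis/(_ (Ordinal t_gt0)).
  by rewrite E -setI_eq0 setIid (negPf (edge_at_neq0 _ _)).
have /c_proper[] : v @: setT \in hyperedges kneser_product.
  apply: disjoint_hyperedge; first by rewrite card_imset // cardsT card_ord.
  move=> _ _ /imsetP[e _ ->] /imsetP[f _ ->] ne; apply: v_dis.
  by apply: contraNneq ne => ->.
exists (c (v 0)) => _ /imsetP[e _ ->]; apply/eqP; rewrite -color_reprP.
by have [_ <-] := vP e; have [_ <-] := vP 0.
Qed.

Lemma block_rot X j : block (vrot X) j = trot (block X j).
Proof.
by apply: eq_from_tnth => i; rewrite tnth_trot !tnth_mktuple ffunE.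
Qed.

Lemma block_le X Y j : vle X Y -> tle (block X j) (block Y j).
Proof. by move=> /vleP XY i; rewrite !tnth_mktuple. Qed.

Lemma block_neq0 X : X != vec0 q position -> exists j, tsupp (block X j) != set0.
Proof.
move=> X0; have [[j i] Xi] : exists i, X i != None.
  apply/existsP; apply: contraNT X0 => /existsPn E; apply/eqP/ffunP => i.
  by rewrite ffunE; apply/eqP; rewrite -[_ == _]negbK E.
by exists j; apply/set0Pn; exists i; rewrite inE tnth_mktuple.
Qed.

Lemma members_le X Y e : vle X Y -> members X e \subset members Y e.
Proof.
move=> XY; apply/subsetP => v /membersP Xv; apply/membersP => j.
apply: subset_trans (Xv j) _; apply: imsetS.
by apply/subsetP => i; rewrite !inE; case: (block_le (j := j) XY i) => ->.
Qed.

Lemma members_rot X e : members (vrot X) (1 + e) = members X e.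
Proof.
by apply/setP => v; rewrite !inE; under eq_forallb => j do rewrite block_rot label_class_rot.
Qed.

Definition full X := [forall j, full_block (s j) (a j) (block X j)].

Lemma full_rot X : full (vrot X) = full X.
Proof. by apply: eq_forallb => j; rewrite block_rot full_block_rot. Qed.

Lemma full_le X Y : vle X Y -> full X -> full Y.
Proof.
move=> XY /forallP fX; apply/forallP => j.
exact: full_block_le (block_le (j := j) XY) (fX j).
Qed.

Lemma full_low X : full X -> (0 < low (colors X))%N.
Proof.
move=> /forallP fX; apply: le_low => e; rewrite card_gt0.
have /fin_all_exists[A AP] j : exists A : kneser_vertex (H j),
    val A \subset s j @: label_class (block X j) e.
  by have [A HA sub] := full_block_labels e (fX j); exists (exist _ A HA).
apply/set0Pn; exists (color_repr [ffun j => A j]); apply: imset_f.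
by apply/membersP => j; rewrite /edge_at ffunE.
Qed.

Variable eta : nat.
Hypothesis eta_le : forall j, (eta + a j <= n j)%N.
Hypothesis eta_ge : (q.+2 <= eta)%N.

Definition level X : nat :=
  if full X then (#|position| - eta + balance (colors X))%N
  else (\sum_j block_level (s j) (a j) (block X j))%N.

Definition level_sgn X : Z :=
  if full X then balance_sgn (colors X)
  else if [pick j | tsupp (block X j) != set0] is Some j
       then block_sgn (s j) (a j) (block X j) else 0.

Lemma card_position : #|position| = (\sum_j n j)%N.
Proof.
by rewrite card_tagged sumnE big_map big_enum /=; apply: eq_bigr => j _; rewrite card_ord.
Qed.

(** The non-full block [j] loses at least [eta - q.+1] against [n j]; every other block is bounded
    by its length. *)
Lemma level_not_full X : ~~ full X -> (level X < #|position| - eta + q.+2)%N.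
Proof.
move=> nf; rewrite /level (negPf nf); case/forallPn: nf => j nf.
rewrite card_position (bigD1 j) //= [X in (_ < X - _ + _)%N](bigD1 j) //=.
have le1 := block_level_not_full nf.
have le2 : (\sum_(i | i != j) block_level (s i) (a i) (block X i) <= \sum_(i | i != j) n i)%N.
  apply: leq_sum => i _; apply: leq_trans (block_level_tsize _ _ _) _.
  by rewrite -[leqRHS]card_ord; exact: max_card.
have arith A B m S : (A <= a j + q.+1 -> B <= S -> eta + a j <= m ->
  A + B < m + S - eta + q.+2)%N by lia.
exact: arith le1 le2 (eta_le j).
Qed.

Lemma level_mono X Y : X != vec0 q position -> vle X Y ->
  (level X <= level Y)%N /\ (level X = level Y -> level_sgn X = level_sgn Y).
Proof.
move=> X0 XY; case: (boolP (full Y)) => [fY|nfY]; last first.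
  have nfX : ~~ full X by apply: contra nfY; exact: full_le.
  rewrite /level /level_sgn (negPf nfX) (negPf nfY).
  have le j := block_level_mono (@alt_edge_free j) (block_le (j := j) XY).
  have lel j : (block_level (s j) (a j) (block X j) <= block_level (s j) (a j) (block Y j))%N.
    by case: (le j).
  split; first exact: leq_sum.
  move=> E; have {}E j : block_level (s j) (a j) (block X j) = block_level (s j) (a j) (block Y j).
    apply/eqP; have := leqif_sum (fun j (_ : true) => leqif_eq (lel j)).
    by case=> _; rewrite E eqxx => /esym/forallP/(_ j).
  (* A block level vanishes only on an empty block, so both vectors pick the same block for the
     sign. *)
  have Es j : (tsupp (block X j) != set0) = (tsupp (block Y j) != set0).
    rewrite -!tsize_gt0; apply/idP/idP => [|Y0];
      first by move=> /leq_trans; apply; apply/tle_tsize/block_le.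
    apply: leq_trans (block_level_tsize (s j) (a j) _); rewrite E.
    by apply: (block_level_gt0 (@alt_edge_free j)); rewrite -tsize_gt0.
  rewrite -(eq_pick Es); case: pickP => // j Xj; exact: (le j).2.
(* A full vector has a color at every label; this lifts its level above every non-full one. *)
have leb : (q.+2 <= balance (colors Y))%N.
  apply: leq_trans (balance_low _); rewrite -[leqLHS]muln1 leq_mul2l.
  by rewrite full_low // orbT.
case: (boolP (full X)) => [fX|nfX].
  have sub e : colors X e \subset colors Y e by apply/imsetS/members_le.
  rewrite /level /level_sgn fX fY leq_add2l; split; first exact: balance_sub.
  by move=> /addnI; exact: eq_balance_sgn.
have lt : (level X < level Y)%N.
  by apply: leq_trans (level_not_full nfX) _; rewrite /level fY leq_add2l.
by split=> [|E]; [exact: ltnW | move: lt; rewrite E ltnn].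
Qed.

Lemma level_gt0 X : X != vec0 q position -> (0 < level X)%N.
Proof.
move=> X0; rewrite /level; case: ifP => [fX|_].
  apply: leq_trans (leq_addl _ _); apply: leq_trans (balance_low _).
  by rewrite muln_gt0 full_low.
have [j Xj] := block_neq0 X0; rewrite (bigD1 j) //=.
by apply: leq_trans (leq_addr _ _); exact: (block_level_gt0 (@alt_edge_free j)).
Qed.

Lemma level_sgn_rot X : X != vec0 q position -> level_sgn (vrot X) = level_sgn X + 1.
Proof.
move=> X0; rewrite /level_sgn full_rot; case: ifP => [fX|_].
  apply: balance_sgn_rot => //; last exact: colors_not_full.
    by move=> e; rewrite /colors members_rot.
  exact: full_low.
rewrite (eq_pick (Q := fun j => tsupp (block X j) != set0)); last first.
  by move=> j; rewrite block_rot tsupp_rot.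
case: pickP => [j Xj|none].
  by rewrite block_rot (block_sgn_rot (@alt_edge_free j) p_prime).
by have [j] := block_neq0 X0; rewrite none.
Qed.

(** As [eta] is at least [q.+2], a non-full vector has level below [#|position|]. The vector given
    by [level_bound] is therefore full. *)
Lemma large_balance : exists X, (eta <= balance (colors X))%N.
Proof.
have eta_pos : (eta <= #|position|)%N.
  rewrite card_position (bigD1 (Ordinal t_gt0)) //=; apply: leq_trans (leq_addr _ _).
  exact: leq_trans (leq_addr _ _) (eta_le _).
have pos0 : (0 < #|position|)%N by exact: leq_trans (leq_trans (ltn0Sn _) eta_ge) eta_pos.
have [X X0 le] : exists2 X, X != vec0 q position & (#|position| <= level X)%N.
  apply: (level_bound level_sgn_rot) => //; first exact: level_gt0.
    by move=> X Y X0 XY; case: (level_mono X0 XY).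
  by move=> X Y X0 XY; case: (level_mono X0 XY).
exists X; case: (boolP (full X)) => [fX|/level_not_full lt].
  move: le; rewrite /level fX.
  have arith N m : (eta <= N -> N <= N - eta + m -> eta <= m)%N by lia.
  exact: arith.
have arith N : (N < N - eta + q.+2 -> q.+2 <= eta <= N -> false)%N by lia.
by have := arith _ (leq_ltn_trans le lt); rewrite eta_ge eta_pos => /(_ isT).
Qed.

Lemma color_section (A : {set V}) k : (k <= #|color_repr @: A|)%N ->
  exists W : {set V}, [/\ W \subset A, #|W| = k & {in W &, injective c}].
Proof.
case/exists_subset_card=> D sub <-.
have /fin_all_exists[f fP] d : exists v, d \in D -> v \in A /\ d = color_repr v.
  case: (boolP (d \in D)) => [/(subsetP sub)/imsetP[v vA ->]|_]; last by exists d.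
  by exists v.
have f_inj : {in D &, injective f}.
  by move=> d d' /fP[_ {2}->] /fP[_ {2}->] ->.
exists (f @: D); split; last 1 first.
- move=> _ _ /imsetP[d dD ->] /imsetP[d' dD' ->] /eqP; rewrite -color_reprP.
  by have [_ <-] := fP d dD; have [_ <-] := fP d' dD' => /eqP ->.
- by apply/subsetP => _ /imsetP[d dD ->]; case: (fP d dD).
- exact: card_in_imset.
Qed.

Lemma balanced_partite : has_colorful_balanced_complete_partite q.+2 c eta.
Proof.
have [X /balance_sizes[k [k_le k_sum k_bal]]] := large_balance.
have /fin_all_exists[W WP] e := color_section (k_le e).
have W_dis e f v w j : e != f -> v \in W e -> w \in W f ->
    [disjoint edge_at v j & edge_at w j].
  move=> ef ve wf; apply: (members_disjoint (X := X) j ef).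
    by have [/subsetP sub _ _] := WP e; exact: sub.
  by have [/subsetP sub _ _] := WP f; exact: sub.
have dis e f : e != f -> [disjoint W e & W f].
  move=> ef; rewrite -setI_eq0; apply/eqP/setP => v; rewrite !inE; apply/negP => /andP[ve vf].
  have := W_dis e f v v (Ordinal t_gt0) ef ve vf.
  by rewrite -setI_eq0 setIid (negPf (edge_at_neq0 _ _)).
have szW e : #|W e| = k e by case: (WP e).
exists W; split=> //.
- by rewrite -[RHS]k_sum; apply: eq_bigr => e _.
- by move=> e f; rewrite !szW.
- move=> E cardE oneE; apply: disjoint_hyperedge => // x y xE yE ne j.
  have cover z : z \in E -> exists e, z \in W e.
    have /fin_all_exists[g gP] e : exists v, v \in E :&: W e.
      by apply/set0Pn; rewrite -card_gt0 oneE.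
    have g_inj : injective g.
      move=> e f ef; apply/eqP; apply: contraT => /dis/disjoint_setI0/setP/(_ (g e)).
      by have := gP e; have := gP f; rewrite -ef !inE => /andP[_ ->] /andP[_ ->].
    (* The transversal [g] already has [q.+2] elements, so it exhausts [E]. *)
    have /eqP <- : g @: setT == E.
      rewrite eqEcard card_imset // cardsT card_ord cardE leqnn andbT.
      by apply/subsetP => _ /imsetP[e _ ->]; have := gP e; rewrite inE => /andP[].
    by case/imsetP=> e _ ->; exists e; have := gP e; rewrite inE => /andP[].
  have [e xe] := cover x xE; have [f yf] := cover y yE.
  apply: (W_dis e f _ _ _ _ xe yf); apply: contraNneq ne => ef; rewrite -ef in yf.
  have /eqP/cards1P[z Ez] := oneE e.
  have : x \in [set z] by rewrite -Ez inE xE.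
  have : y \in [set z] by rewrite -Ez inE yE.
  by rewrite !inE => /eqP-> /eqP->.
- by move=> e; case: (WP e).
Qed.

End KneserProduct.

(** * Optimal orderings and the case of few vertices *)

Lemma alt_number_ordering p (H : hypergraph) :
  exists2 s : ordering H, injective s & alt_number p H = alt_ordering p s.
Proof.
rewrite /alt_number; case: arg_minnP => [|s /injectiveP s_inj _]; last by exists s.
by apply/injectiveP => i j; rewrite !ffunE; exact: enum_val_inj.
Qed.

(** Labels 0 and 1 suffice; the induction remembers the previous nonzero label as [x0]. *)
Lemma alternating_fill q (b : seq bool) : exists X : seq (option 'I_q.+2),
  [/\ size X = size b, map isSome X = b & alternating [seq x <- X | isSome x]].
Proof.
suff [X [szX mX pX]] : exists X : seq (option 'I_q.+2), [/\ size X = size b,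
    map isSome X = b & path (fun x y => x != y) None [seq x <- X | isSome x]].
  by exists X; split=> //; rewrite /alternating filter_all; exact: path_sorted pX.
elim: b None => [|[] b IH] x0; first by exists [::].
  have [X [szX mX pX]] := IH (if x0 == Some 0 then Some 1 else Some 0).
  exists ((if x0 == Some 0 then Some 1 else Some 0) :: X).
  split; rewrite /= ?szX ?mX //; first by case: ifP.
  by case: eqP pX => [->|/eqP ne] /= ->; rewrite ?andbT.
have [X [szX mX pX]] := IH x0.
by exists (None :: X); split; rewrite /= ?szX ?mX.
Qed.

(** Pick a vertex in every edge. A vector that is zero on the picked vertices and alternates on the
    rest is edge-free, so [alt] misses at most one position per edge. *)
Lemma alt_defect_card q (H : hypergraph) : (alt_defect q.+2 H <= #|kneser_vertex H|)%N.
Proof.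
have [s s_inj altE] := alt_number_ordering q.+2 H.
have /fin_all_exists[f fP] (A : kneser_vertex H) : exists x, x \in val A.
  by apply/set0Pn; apply: contraNneq (hyperedges_neq0 H) => <-; exact: valP.
pose D := f @: [set: kneser_vertex H].
have cD : (#|D| <= #|kneser_vertex H|)%N by rewrite -cardsT leq_imset_card.
pose b := [tuple s i \notin D | i < #|vertex H|].
have [X0 [szX0 mX0 aX0]] := alternating_fill q b.
have /eqP szX : size X0 = #|vertex H| by rewrite szX0 size_tuple.
pose X : signed_vector q.+2 #|vertex H| := Tuple szX.
have Xb i : isSome (tnth X i) = (s i \notin D).
  rewrite -[RHS](tnth_mktuple (fun i => s i \notin D)) -/b (tnth_nth true) -[tval b]mX0.
  by rewrite (nth_map None) ?(eqP szX) // (tnth_nth None).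
have freeX : edge_free s X.
  apply/existsPn => e; apply/negP => /exists_inP[A HA /subsetP sub].
  have /sub/imsetP[i] := fP (exist _ A HA); rewrite inE => /eqP Xi fA.
  by have := Xb i; rewrite Xi -fA imset_f.
have le_alt : (#|vertex H| - #|D| <= alt X)%N.
  apply: leq_trans (alt_ge (filter_subseq isSome X) aX0); rewrite size_nonzero.
  have -> : tsize X = #|~: (s @^-1: D)|.
    by apply: eq_card => i; rewrite !inE -Xb; case: (tnth X i).
  rewrite [leqRHS]cardsCs setCK card_ord leq_sub2l // -(card_imset _ s_inj) subset_leq_card //.
  by apply/subsetP => _ /imsetP[i + ->]; rewrite inE.
have le_ord : (alt X <= alt_ordering q.+2 s)%N by exact: leq_bigmax_cond.
rewrite /alt_defect altE leq_subLR addnC -leq_subLR; apply: leq_trans le_ord.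
by apply: leq_trans le_alt; rewrite leq_sub2l.
Qed.

Lemma product_card q t (t_gt0 : (0 < t)%N) (p_prime : prime q.+2) (H : 'I_t -> hypergraph) m :
  (forall j, (m <= #|kneser_vertex (H j)|)%N) ->
  (m <= #|vertex (categorical_product t_gt0 (fun i => kneser (prime_gt0 p_prime) (H i)))|)%N.
Proof.
(* Some factor may be empty if [m] is 0. Otherwise all coordinates but one can be fixed while that
   one varies. *)
case: m => // m le.
have /fin_all_exists[v0 _] j : exists v : kneser_vertex (H j), true.
  by have /card_gt0P[v _] := leq_ltn_trans (leq0n m) (le j); exists v.
pose j0 := Ordinal t_gt0.
pose f (A : kneser_vertex (H j0)) :
  vertex (categorical_product t_gt0 (fun i => kneser (prime_gt0 p_prime) (H i))) :=
  [ffun j => dfwith v0 A j].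
have f_inj : injective f.
  by move=> A B /ffunP/(_ j0); rewrite !ffunE !dfwith_in.
exact: leq_trans (le j0) (leq_card f f_inj).
Qed.

(* With fewer vertices than parts some part is empty, and nothing is required of
   the hyperedges. *)
Lemma partite_of_card q (G : hypergraph) (C : eqType) (c : vertex G -> C) m :
  (m < q.+2)%N -> (m <= #|vertex G|)%N -> has_colorful_balanced_complete_partite q.+2 c m.
Proof.
move=> m_lt; rewrite -cardsT => /exists_subset_card[D _ cD].
pose f x : 'I_q.+2 := inord (index x (enum D)).
have fE x : x \in D -> f x = index x (enum D) :> nat /\ (f x < m)%N.
  rewrite -mem_enum -index_mem -cardE cD => lt.
  by rewrite /f inordK // (ltn_trans lt).
have f_inj : {in D &, injective f}.
  move=> x y xD yD /(congr1 val) /=; rewrite (fE x xD).1 (fE y yD).1.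
  by apply: (@index_inj _ x); rewrite mem_enum.
pose W i := [set x in D | f x == i].
have W1 i x y : x \in W i -> y \in W i -> x = y.
  by rewrite !inE => /andP[xD /eqP <-] /andP[yD /eqP E]; exact: f_inj.
have W_le1 i : (#|W i| <= 1)%N.
  by apply/card_le1_eqP => x y xW yW; exact: W1 yW xW.
exists W; split.
- move=> i j ij; rewrite -setI_eq0; apply/eqP/setP => x; rewrite !inE; apply/negP.
  by case/andP=> /andP[_ /eqP Ei] /andP[_ /eqP Ej]; rewrite -Ei -Ej eqxx in ij.
- rewrite -cD -sum1_card (partition_big f xpredT) //=; apply: eq_bigr => i _.
  by rewrite -sum1_card; apply: eq_bigl => x; rewrite inE.
- by move=> i j; rewrite (leq_trans (W_le1 i)) // leq_addl.
- move=> e _ /(_ (inord m)) /eqP/cards1P[x /setP/(_ x)]; rewrite !inE eqxx.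
  case/andP=> _ /andP[xD /eqP fx]; have [_] := fE x xD.
  by rewrite fx inordK // ltnn.
- by move=> i x y xW yW _; exact: W1 xW yW.
Qed.

Local Close Scope ring_scope.

Theorem theorem3 (p t : nat) (p_prime : prime p) (t_gt0 : 0 < t)
    (H : 'I_t -> hypergraph) (C : eqType)
    (c : vertex (categorical_product t_gt0
                   (fun i => kneser (prime_gt0 p_prime) (H i))) -> C) :
  proper_coloring c ->
  has_colorful_balanced_complete_partite p c (min_alt_defect p t_gt0 H).
Proof.
case: p p_prime c => [|[|q]] // p_prime c c_proper.
set eta := min_alt_defect _ _ _.
have eta_le j : (eta <= alt_defect q.+2 (H j))%N.
  by rewrite /eta /min_alt_defect; case: arg_minnP => // i _; apply.
have [eta_ge|eta_lt] := leqP q.+2 eta; last first.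
  apply: partite_of_card => //; apply: product_card => j.
  exact: leq_trans (eta_le j) (alt_defect_card q (H j)).
have /fin_all_exists2[s s_inj altE] j := alt_number_ordering q.+2 (H j).
apply: (balanced_partite c_proper s_inj (a := fun j => alt_number q.+2 (H j))) => //.
  by move=> j X fX; rewrite altE; exact: leq_bigmax_cond.
move=> j; rewrite addnC -leq_subRL; first exact: eta_le.
(* The truncated difference in [alt_defect] is positive, as [eta] is, so nothing was cut off. *)
by apply: ltnW; rewrite -subn_gt0; exact: leq_trans (leq_trans (ltn0Sn _) eta_ge) (eta_le j).
Qed.
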